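(* Let $V$ be a real algebraic variety and let $X \subseteq V$ be a compact subset. Then, for each positive integer $n$, every continuous map from $X$ into the unit $n$-sphere $\mathbb{S}^n = \{(u_0,\ldots,u_n)\in\mathbb{R}^{n+1} : u_0^2+\cdots+u_n^2=1\}$ can be approximated by piecewise-regular maps; that is, for every continuous map $f\colon X\to\mathbb{S}^n$, every neighborhood of $f$ in $\mathcal{C}(X,\mathbb{S}^n)$ contains a piecewise-regular map.
   Context: A real algebraic variety is a locally ringed space isomorphic to an algebraic subset of $\mathbb{R}^m$ (for some $m$) endowed with the Zariski topology and the sheaf of real-valued regular functions (functions locally of the form $P/Q$ with $P,Q$ polynomials, $Q$ nowhere zero). Morphisms of real algebraic varieties are called regular maps. Each real algebraic variety also carries the Euclidean topology; all topological notions (compact, continuous, connected component, ...) refer to the Euclidean topology unless ''Zariski'' is specified. Regular map on a subset: let $V,W$ be real algebraic varieties, $X\subseteq V$ any subset, $Z$ the Zariski closure of $X$ in $V$. A map $f\colon X\to W$ is regular if there exist a Zariski open neighborhood $Z_0\subseteq Z$ of $X$ and a regular map $\tilde f\colon Z_0\to W$ with $\tilde f|_X=f$. A stratification of $V$ is a finite collection of pairwise disjoint Zariski locally closed subvarieties of $V$ (some possibly empty) whose union is $V$. A continuous map $f\colon X\to W$ is piecewise $\mathcal{S}$-regular, for a stratification $\mathcal{S}$ of $V$, if for every $S\in\mathcal{S}$ the restriction of $f$ to each connected component of $X\cap S$ is a regular map. It is piecewise-regular if it is piecewise $\mathcal{T}$-regular for some stratification $\mathcal{T}$ of $V$. $\mathcal{C}(X,W)$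 is the space of continuous maps from $X$ into $W$ with the compact-open topology. *)

(* Defs.v *)
From HB Require Import structures.
From mathcomp Require Import all_boot all_order all_algebra.
From mathcomp Require Import all_classical all_reals all_analysis.
(* the notations of mpoly clash with those of MathComp-Analysis *)
From mathcomp Require Import -(notations) mpoly.

Set Implicit Arguments.
Unset Strict Implicit.
Unset Printing Implicit Defensive.

Import Order.TTheory GRing.Theory Num.Theory.
Import numFieldNormedType.Exports.

Local Open Scope classical_set_scope.
Local Open Scope ring_scope.

Definition peval (R : realType) (m : nat) (p : mpoly m R)
  (x : 'rV[R]_m) : R := meval (x ord0) p.

Definition algebraic (R : realType) (m : nat) (A : set 'rV[R]_m) :=
  exists P : set (mpoly m R),
    A = [set x | forall p, P p -> peval p x = 0].

(* A space endowed with a sheaf of real-valued functions. A section over [U] is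
   represented by any total function extending it, and [regfun U] is meaningful
   for [zopen U] only. The axioms (topology, sheaf, local rings) are not fields:
   for varieties, the only spaces used below, they follow from the existence of
   a chart. *)
Record funSpace (R : realType) := FunSpace {
  carrier :> Type ;
  zopen : set (set carrier) ;
  regfun : set carrier -> set (carrier -> R) }.

HB.instance Definition _ (R : realType) (S : funSpace R) :=
  gen_eqMixin (carrier S).
HB.instance Definition _ (R : realType) (S : funSpace R) :=
  gen_choiceMixin (carrier S).

Section FunSpaces.
Context {R : realType}.
Implicit Types S T : funSpace R.

Definition regular_map S T (phi : S -> T) :=
  (forall U, zopen U -> zopen (phi @^-1` U)) /\
  (forall U g, zopen U -> regfun U g -> regfun (phi @^-1` U) (g \o phi)).

Definition isomorphism S T (phi : S -> T) :=
  regular_map phi /\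
  exists psi : T -> S, [/\ cancel phi psi, cancel psi phi & regular_map psi].

Definition zclosed S (F : set S) := zopen (~` F).

Definition locally_zclosed S (A : set S) :=
  exists U F, [/\ zopen U, zclosed F & A = U `&` F].

Definition zclosure S (A : set S) : set S :=
  \bigcap_(F in [set F | zclosed F /\ A `<=` F]) F.

Definition affine (m : nat) (A : set 'rV[R]_m) : funSpace R :=
  @FunSpace R A
    [set U | exists2 B, algebraic B & U = [set x | ~ B (val x)]]
    (fun U => [set f | forall x, U x ->
       exists O p q,
         [/\ exists2 B, algebraic B & O = [set x : A | ~ B (val x)],
             O x, O `<=` U &
             forall y, O y -> peval q (val y) != 0 /\
                              f y = peval p (val y) / peval q (val y)]]).

(* The structure induced on a subset: subspace Zariski topology, and functions
   that are locally restrictions of regular functions of the ambient space. *)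
Definition induced S (Z : set S) : funSpace R :=
  @FunSpace R Z
    [set U | exists2 O, zopen O & U = val @^-1` O]
    (fun U => [set f | forall x, U x ->
       exists O g,
         [/\ zopen O, regfun O g, O (val x) &
             forall y : Z, O (val y) -> U y /\ f y = g (val y)]]).

End FunSpaces.

Record variety (R : realType) := Variety {
  vspace :> funSpace R ;
  vdim : nat ;
  vmodel : set 'rV[R]_vdim ;
  vmodel_algebraic : algebraic vmodel ;
  vchart : vspace -> affine vmodel ;
  vchart_iso : isomorphism vchart }.

(* The Euclidean topology, pulled back along the chart; since regular maps
   between algebraic sets are continuous, it does not depend on the chart. *)
Definition vembed (R : realType) (V : variety R) (x : V) : 'rV[R]_(vdim V) :=
  val (vchart x).

HB.instance Definition _ (R : realType) (V : variety R) :=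
  Topological.copy (carrier (vspace V)) (initial_topology (@vembed R V)).

Section PiecewiseRegular.
Context {R : realType} {V W : variety R}.

(* regularity of the restriction of [f] to a subset [C] of its domain [X] *)
Definition regular_on (X : set V) (f : X -> W) (C : set V) :=
  exists O : set V, [/\ zopen O, C `<=` O &
    exists2 g : induced (zclosure C `&` O) -> W, regular_map g &
      forall (x : X) (z : induced (zclosure C `&` O)),
        C (val x) -> val z = val x -> g z = f x].

Definition stratification (SS : set (set V)) :=
  [/\ finite_set SS, forall S, SS S -> locally_zclosed S,
      trivIset SS id & \bigcup_(S in SS) S = setT].

Definition piecewise_regular_for (SS : set (set V)) (X : set V) (f : X -> W) :=
  continuous f /\
  forall S x, SS S -> (X `&` S) x ->
    regular_on f (connected_component (X `&` S) x).

Definition piecewise_regular (X : set V) (f : X -> W) :=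
  exists2 SS, stratification SS & piecewise_regular_for SS f.

End PiecewiseRegular.

Section Sphere.
Context {R : realType} (n : nat).

Definition sphere_set : set 'rV[R]_n.+1 :=
  [set u | \sum_(i < n.+1) u ord0 i ^+ 2 = 1].

Lemma sphere_algebraic : algebraic sphere_set.
Proof.
pose p : mpoly n.+1 R := \sum_(i < n.+1) mpolyX R (mnm1 i) ^+ 2 - 1.
have pE u : peval p u = \sum_(i < n.+1) u ord0 i ^+ 2 - 1.
  rewrite /peval mevalB meval1 raddf_sum /=; congr (_ - 1).
  by apply: eq_bigr => i _; rewrite expr2 mevalM mevalXU -expr2.
exists [set p]; apply/seteqP; split=> u /= => [su q ->|/(_ _ erefl)].
  by rewrite pE su subrr.
by rewrite pE => /eqP; rewrite subr_eq0 => /eqP.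
Qed.

Lemma regular_map_id (S : funSpace R) : regular_map (@id S).
Proof. by split. Qed.

Lemma isomorphism_id (S : funSpace R) : isomorphism (@id S).
Proof.
by split; [|exists id; split=> //]; exact: regular_map_id.
Qed.

Definition sphere : variety R :=
  Variety sphere_algebraic (isomorphism_id (affine sphere_set)).

End Sphere.
Arguments sphere : clear implicits.

(* Main.v *)
(** Embed [V] in [R^m]. If [X] is compact, [f : X -> S^n] is uniformly
    approximated by convex combinations [sum_c t_c f(c) / sum_c t_c], where the
    [t_c] are tent functions: the result [F] is continuous and piecewise
    rational, but only close to the sphere. The nearest-point retraction
    [u / |u|] is not piecewise rational, since it involves a square root.
    However, there is a continuous piecewise rational retraction of
    [R^(n+1) \ 0] onto [S^n]: it is obtained from inverse stereographic
    projections from the two poles, whose scales are chosen so that they agree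
    on the equatorial hyperplane [u_0 = 0], even off the sphere. Composing [F]
    with it gives a map whose formula depends only on the signs of finitely many
    polynomials. Stratifying [V] by the vanishing pattern of these polynomials,
    their signs are constant on each connected component of [X] intersected with
    a stratum, so the map is regular there. *)
Require Import Defs.
From HB Require Import structures.
From mathcomp Require Import all_boot all_order all_algebra.
From mathcomp Require Import all_classical all_reals all_analysis.
From mathcomp Require Import -(notations) mpoly.
From mathcomp Require Import ring lra.

Set Implicit Arguments.
Unset Strict Implicit.
Unset Printing Implicit Defensive.

Import Order.TTheory GRing.Theory Num.Theory.
Import numFieldNormedType.Exports.

Local Open Scope classical_set_scope.
Local Open Scope ring_scope.

(** * Pointwise continuity of algebraic operations *)

Section ContinuousAt.
Context {R : realType} {T : topologicalType}.

Lemma continuous_atD (f g : T -> R) x : {for x, continuous f} ->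
  {for x, continuous g} -> {for x, continuous (fun y => f y + g y)}.
Proof. by move=> cf cg; apply: cvgD. Qed.

Lemma continuous_atM (f g : T -> R) x : {for x, continuous f} ->
  {for x, continuous g} -> {for x, continuous (fun y => f y * g y)}.
Proof. by move=> cf cg; apply: cvgM. Qed.

Lemma continuous_at_cst (c : R) x : {for x, continuous (fun _ : T => c)}.
Proof. exact: cvg_cst. Qed.

Lemma continuous_atV (f : T -> R) x : f x != 0 ->
  {for x, continuous f} -> {for x, continuous (fun y => (f y)^-1)}.
Proof. by move=> f0 cf; apply: cvgV. Qed.

Lemma continuous_at_max (f g : T -> R) x : {for x, continuous f} ->
  {for x, continuous g} -> {for x, continuous (fun y => Num.max (f y) (g y))}.
Proof. exact: continuous_max. Qed.

Lemma continuous_atN (f : T -> R) x :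
  {for x, continuous f} -> {for x, continuous (fun y => - f y)}.
Proof. by move=> cf; apply: cvgN. Qed.

Lemma continuous_atX (f : T -> R) k x :
  {for x, continuous f} -> {for x, continuous (fun y => f y ^+ k)}.
Proof.
move=> cf; apply: (@continuous_comp _ _ _ f (fun t => t ^+ k)) => //.
exact: exprn_continuous.
Qed.

Lemma continuous_at_eq_near (U : topologicalType) (f g : T -> U) x :
  (\forall y \near x, f y = g y) -> {for x, continuous g} ->
  {for x, continuous f}.
Proof.
move=> fg cg; rewrite /prop_for /continuous_at (nbhs_singleton fg).
apply: cvg_trans cg; apply: near_eq_cvg.
by apply: filterS fg => y ->.
Qed.

Lemma continuous_at_row k (f : T -> 'rV[R]_k) x :
  (forall i, {for x, continuous (fun y => f y ord0 i)}) ->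
  {for x, continuous f}.
Proof.
move=> cf A [P PA sPA]; rewrite nbhs_filterE.
have Pf : \forall y \near x, forall j, P ord0 j (f y ord0 j).
  by apply: filter_forall => j; exact: cf (PA ord0 j).
by apply: filterS Pf => y Py; apply: sPA => i j; rewrite ord1.
Qed.

Lemma continuous_at_sum I (r : seq I) (P : pred I)
    (F : I -> T -> R) x :
  (forall i, P i -> {for x, continuous (F i)}) ->
  {for x, continuous (fun y => \sum_(i <- r | P i) F i y)}.
Proof.
move=> cF; apply: (@cvg_big R I +%R 0 P) => // -[a b].
by apply: cvgD; [exact: cvg_fst | exact: cvg_snd].
Qed.

Lemma continuous_at_prod I (r : seq I) (P : pred I)
    (F : I -> T -> R) x :
  (forall i, P i -> {for x, continuous (F i)}) ->
  {for x, continuous (fun y => \prod_(i <- r | P i) F i y)}.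
Proof.
move=> cF; apply: (@cvg_big R I *%R 1 P) => // -[a b].
by apply: cvgM; [exact: cvg_fst | exact: cvg_snd].
Qed.

End ContinuousAt.

(** * Rational and piecewise rational functions on [R^m] *)

Section RationalFunctions.
Context {R : realType} {m : nat}.
Implicit Types (D : set 'rV[R]_m) (f g : 'rV[R]_m -> R) (h p q : mpoly m R).
Local Notation peval := (@peval R m).

(** A single quotient must serve all of [D], so that denominators can be cleared on [D] as a
    whole. *)
Definition rational_on D f := exists p q,
  forall y, D y -> peval q y != 0 /\ f y = peval p y / peval q y.

Lemma pevalD p q y : peval (p + q) y = peval p y + peval q y.
Proof. exact: mevalD. Qed.

Lemma pevalM p q y : peval (p * q) y = peval p y * peval q y.
Proof. exact: mevalM. Qed.

Lemma peval1 y : peval (1 : mpoly m R) y = 1.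
Proof. exact: meval1. Qed.

Lemma pevalC c y : peval (mpolyC m c) y = c.
Proof. exact: mevalC. Qed.

Lemma peval_prod I (r : seq I) (P : pred I) (F : I -> mpoly m R) y :
  peval (\prod_(i <- r | P i) F i) y = \prod_(i <- r | P i) peval (F i) y.
Proof. exact: rmorph_prod. Qed.

Lemma rational_on_sub D D' f :
  D `<=` D' -> rational_on D' f -> rational_on D f.
Proof. by move=> DD' [p [q pq]]; exists p, q => y /DD'/pq. Qed.

Lemma rational_on_cst D c : rational_on D (cst c).
Proof.
by exists (mpolyC m c), 1 => y _; rewrite peval1 pevalC divr1 oner_neq0.
Qed.

Lemma rational_on_peval D p : rational_on D (peval p).
Proof. by exists p, 1 => y _; rewrite peval1 divr1 oner_neq0. Qed.

Lemma rational_onD D f g :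
  rational_on D f -> rational_on D g -> rational_on D (f \+ g).
Proof.
move=> [p [q pq]] [p' [q' pq']]; exists (p * q' + p' * q), (q * q') => y Dy.
have [[q0 /= ->] [q'0 ->]] := (pq y Dy, pq' y Dy).
by rewrite pevalD !pevalM mulf_neq0// addf_div.
Qed.

Lemma rational_onM D f g :
  rational_on D f -> rational_on D g -> rational_on D (f \* g).
Proof.
move=> [p [q pq]] [p' [q' pq']]; exists (p * p'), (q * q') => y Dy.
have [[q0 /= ->] [q'0 ->]] := (pq y Dy, pq' y Dy).
by rewrite !pevalM mulf_neq0// mulf_div.
Qed.

Lemma rational_onV D f : (forall y, D y -> f y != 0) ->
  rational_on D f -> rational_on D (fun y => (f y)^-1).
Proof.
move=> f0 [p [q pq]]; exists q, p => y Dy.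
have [q0 fE] := pq y Dy; split; last by rewrite fE invf_div.
by have := f0 y Dy; rewrite fE mulf_eq0 invr_eq0 negb_or => /andP[].
Qed.

Lemma rational_on_eq D f g : (forall y, D y -> f y = g y) ->
  rational_on D g -> rational_on D f.
Proof.
by move=> fg [p [q pq]]; exists p, q => y Dy; rewrite fg//; exact: pq.
Qed.

Lemma rational_on_sum D I (r : seq I) (F : I -> 'rV[R]_m -> R) :
  (forall i, rational_on D (F i)) ->
  rational_on D (fun y => \sum_(i <- r) F i y).
Proof.
move=> ratF; elim: r => [|i r ih].
  by apply: rational_on_eq (rational_on_cst D 0) => y _; rewrite big_nil.
by apply: rational_on_eq (rational_onD (ratF i) ih) => y _; rewrite big_cons.
Qed.

Lemma rational_on_prod D I (r : seq I) (F : I -> 'rV[R]_m -> R) :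
  (forall i, rational_on D (F i)) ->
  rational_on D (fun y => \prod_(i <- r) F i y).
Proof.
move=> ratF; elim: r => [|i r ih].
  by apply: rational_on_eq (rational_on_cst D 1) => y _; rewrite big_nil.
by apply: rational_on_eq (rational_onM (ratF i) ih) => y _; rewrite big_cons.
Qed.

Lemma rational_onX D f k :
  rational_on D f -> rational_on D (fun y => f y ^+ k).
Proof.
move=> ratf; elim: k => [|k ih]; first exact: rational_on_cst.
by apply: rational_on_eq (rational_onM ratf ih) => y _; rewrite exprS.
Qed.

Lemma rational_on_comp D k (r : 'rV[R]_m -> 'rV[R]_k) (P : mpoly k R) :
  (forall i, rational_on D (fun y => r y ord0 i)) ->
  rational_on D (fun y => Defs.peval P (r y)).
Proof.
move=> ratr; apply: rational_on_eq => [y _|].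
  by rewrite /Defs.peval mevalE.
apply: rational_on_sum => c; apply: rational_onM; first exact: rational_on_cst.
by apply: rational_on_prod => i; exact: rational_onX.
Qed.

(** Clearing denominators: on [D], an equation [P (r y) = 0] says that a numerator of [P (r y)]
    vanishes. *)
Lemma algebraic_preimage D k (r : 'rV[R]_m -> 'rV[R]_k) (B : set 'rV[R]_k) :
    (forall i, rational_on D (fun y => r y ord0 i)) -> algebraic B ->
  exists2 B', algebraic B' & forall y, D y -> B' y <-> B (r y).
Proof.
move=> ratr [Ps ->].
(* All numerators of all equations in [Ps] are taken together, which avoids choosing one for each
   [P]. *)
exists [set y | forall a, (exists P b, Ps P /\ forall y, D y ->
    peval b y != 0 /\ Defs.peval P (r y) = peval a y / peval b y) ->
  peval a y = 0].
  by eexists.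
move=> y Dy; split=> /= [zero P PsP|zero a [P [b [PsP /(_ y Dy)[b0 PE]]]]].
  have [a [b abP]] := rational_on_comp P ratr.
  by have [_ ->] := abP y Dy; rewrite zero ?mul0r//; exists P, b.
move: PE; rewrite zero// => /esym/eqP.
by rewrite mulf_eq0 invr_eq0 (negPf b0) orbF => /eqP.
Qed.

(** Multiplying every equation of [B] by [q] adds the zeros of [q]. *)
Lemma algebraicU0 (B : set 'rV[R]_m) q : algebraic B ->
  algebraic (B `|` [set y | peval q y = 0]).
Proof.
move=> [P ->]; exists [set p * q | p in P]; apply/seteqP; split=> y /=.
  move=> [Py _ [p Pp <-]|q0 _ [p Pp <-]]; rewrite pevalM.
    by rewrite Py ?mul0r.
  by rewrite q0 mulr0.
move=> pqy; have [q0|q0] := eqVneq (peval q y) 0; first by right.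
left=> p Pp; have /pqy/eqP : [set p * q | p in P] (p * q) by exists p.
by rewrite pevalM mulf_eq0 (negPf q0) orbF => /eqP.
Qed.

Lemma algebraic0 q : algebraic [set y : 'rV[R]_m | peval q y = 0].
Proof.
by exists [set q]; apply/seteqP; split=> y /= => [q0 _ ->|/(_ q)]; auto.
Qed.

(** Only [0 <= h] is tested; adding [- h] to the family separates the zeros of [h] from its positive
    values. *)
Definition sign_cell (hs : seq (mpoly m R)) (y : 'rV[R]_m) : set 'rV[R]_m :=
  [set z | forall h, h \in hs -> (0 <= peval h z) = (0 <= peval h y)].

(** The family is fixed, while the quotient may change with the cell. Continuity is not built in, so
    the class is closed under inverses and case distinctions. *)
Definition piecewise_rational f :=
  exists hs, forall y, rational_on (sign_cell hs y) f.

Lemma sign_cell_catl hs hs' y : sign_cell (hs ++ hs') y `<=` sign_cell hs y.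
Proof. by move=> z hz h hhs; apply: hz; rewrite mem_cat hhs. Qed.

Lemma sign_cell_catr hs hs' y : sign_cell (hs ++ hs') y `<=` sign_cell hs' y.
Proof. by move=> z hz h hhs; apply: hz; rewrite mem_cat hhs orbT. Qed.

Lemma piecewise_rational_peval p : piecewise_rational (peval p).
Proof. by exists [::] => y; exact: rational_on_peval. Qed.

Lemma piecewise_rational_cst c : piecewise_rational (cst c).
Proof. by exists [::] => y; exact: rational_on_cst. Qed.

Lemma piecewise_rational_coord i : piecewise_rational (fun y => y ord0 i).
Proof.
rewrite (_ : (fun y => _) = peval (mpolyX R (mnm1 i))).
  exact: piecewise_rational_peval.
by apply/funext => y; rewrite /Defs.peval mevalXU.
Qed.

Lemma piecewise_rationalD f g : piecewise_rational f ->
  piecewise_rational g -> piecewise_rational (fun y => f y + g y).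
Proof.
move=> [hs ratf] [hs' ratg]; exists (hs ++ hs') => y; apply: rational_onD.
  by apply: rational_on_sub (ratf y); exact: sign_cell_catl.
by apply: rational_on_sub (ratg y); exact: sign_cell_catr.
Qed.

Lemma piecewise_rationalM f g : piecewise_rational f ->
  piecewise_rational g -> piecewise_rational (fun y => f y * g y).
Proof.
move=> [hs ratf] [hs' ratg]; exists (hs ++ hs') => y; apply: rational_onM.
  by apply: rational_on_sub (ratf y); exact: sign_cell_catl.
by apply: rational_on_sub (ratg y); exact: sign_cell_catr.
Qed.

Lemma piecewise_rationalN f :
  piecewise_rational f -> piecewise_rational (fun y => - f y).
Proof.
move=> ratf; rewrite (_ : (fun y => _) = (fun y => cst (-1) y * f y)).
  by apply: piecewise_rationalM => //; exact: piecewise_rational_cst.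
by apply/funext => y; rewrite mulN1r.
Qed.

(* There are only finitely many sign cells, so the polynomials whose signs
   decide the sign of [f] on each of them can be added to the family. *)
Lemma piecewise_rational_sign f : piecewise_rational f ->
  exists hs, forall y, rational_on (sign_cell hs y) f /\
    forall z, sign_cell hs y z -> (0 <= f z) = (0 <= f y).
Proof.
move=> [hs ratf].
pose pat y := [tuple of [seq 0 <= peval h y | h <- in_tuple hs]].
have pat_cell y z : pat z = pat y <-> sign_cell hs y z.
  split=> [/(congr1 val)/eq_in_map//|yz].
  by apply/val_inj/eq_in_map.
have /choice[pq pqP] t : exists pq : mpoly m R * mpoly m R,
    forall y, pat y = t ->
    peval pq.2 y != 0 /\ f y = peval pq.1 y / peval pq.2 y.
  have [[y yt]|no] := pselect (exists y, pat y = t).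
    have [p [q pq]] := ratf y; exists (p, q) => z zt.
    by apply: pq; apply/pat_cell; rewrite zt.
  (* A pattern realized by no point gets a dummy pair. *)
  by exists (0, 1) => y yt; case: no; exists y.
(* Multiplying by the positive square of the denominator turns the sign of a quotient into that of a
   polynomial. *)
have fsign y : (0 <= f y) = (0 <= peval ((pq (pat y)).1 * (pq (pat y)).2) y).
  have [q0 ->] := pqP _ y erefl; rewrite pevalM.
  have q2 : 0 < peval (pq (pat y)).2 y ^+ 2 by rewrite exprn_even_gt0.
  by rewrite -(pmulr_lge0 (_ / _) q2) expr2 mulrA divfK.
exists (hs ++ [seq (pq t).1 * (pq t).2 | t <- enum {: (size hs).-tuple bool}]).
move=> y; split.
  by apply: rational_on_sub (ratf y); exact: sign_cell_catl.
move=> z yz; have yz' : pat z = pat y.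
  by apply/pat_cell; exact: sign_cell_catl yz.
rewrite !fsign yz'; apply: (sign_cell_catr yz).
by apply/mapP; exists (pat y) => //; rewrite mem_enum.
Qed.

(** Once the signs of both [f] and [- f] are fixed, [f] is identically zero or nowhere zero on a
    cell. In the first case the inverse is constantly 0, by the convention on [0^-1]. *)
Lemma piecewise_rationalV f :
  piecewise_rational f -> piecewise_rational (fun y => (f y)^-1).
Proof.
move=> ratf; have [hs fs] := piecewise_rational_sign ratf.
have [hs' Nfs] := piecewise_rational_sign (piecewise_rationalN ratf).
exists (hs ++ hs') => y.
have f0 z : sign_cell (hs ++ hs') y z -> (f z == 0) = (f y == 0).
  move=> yz; rewrite !eq_le -!(oppr_ge0 (f _)).
  have [_ ->] := fs y; last exact: sign_cell_catl yz.
  by have [_ ->] := Nfs y; last exact: sign_cell_catr yz.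
have [fy0|fy0] := eqVneq (f y) 0.
  apply: rational_on_eq (rational_on_cst _ 0) => z /f0.
  by rewrite fy0 eqxx => /eqP ->; rewrite invr0.
apply: rational_onV => [z /f0 ->//|].
by have [ratfy _] := fs y; apply: rational_on_sub ratfy; exact: sign_cell_catl.
Qed.

Lemma piecewise_rational_if e f g :
    piecewise_rational e -> piecewise_rational f -> piecewise_rational g ->
  piecewise_rational (fun y => if 0 <= e y then f y else g y).
Proof.
move=> /piecewise_rational_sign[hs hP] [fs ratf] [gs ratg].
exists (hs ++ fs ++ gs) => y.
have hy z : sign_cell (hs ++ fs ++ gs) y z -> (0 <= e z) = (0 <= e y).
  by move/sign_cell_catl; have [_] := hP y; exact.
case: (boolP (0 <= e y)) => [h0|/negPf h0].
  apply: (@rational_on_eq _ _ f) => [z /hy ->|]; first by rewrite h0.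
  apply: rational_on_sub (ratf y).
  by apply: subset_trans (@sign_cell_catl _ gs y); exact: sign_cell_catr.
apply: (@rational_on_eq _ _ g) => [z /hy ->|]; first by rewrite h0.
apply: rational_on_sub (ratg y).
by apply: subset_trans (@sign_cell_catr fs _ y); exact: sign_cell_catr.
Qed.

Lemma piecewise_rational_max f g : piecewise_rational f ->
  piecewise_rational g -> piecewise_rational (fun y => Num.max (f y) (g y)).
Proof.
move=> ratf ratg; rewrite (_ : (fun y => _) =
    (fun y => if 0 <= f y + - g y then f y else g y)).
  apply: piecewise_rational_if => //; apply: piecewise_rationalD => //.
  exact: piecewise_rationalN.
by apply/funext => y; rewrite subr_ge0 maxC maxEle.
Qed.

Lemma piecewise_rational_sum I (r : seq I) (P : pred I)
    (F : I -> 'rV[R]_m -> R) :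
  (forall i, piecewise_rational (F i)) ->
  piecewise_rational (fun y => \sum_(i <- r | P i) F i y).
Proof.
move=> ratF; elim: r => [|i r ih].
  under [fun y => _]funext do rewrite big_nil.
  exact: piecewise_rational_cst.
under [fun y => _]funext do rewrite big_cons.
by case: (P i) => //; exact: piecewise_rationalD.
Qed.

Lemma piecewise_rational_prod I (r : seq I) (F : I -> 'rV[R]_m -> R) :
  (forall i, piecewise_rational (F i)) ->
  piecewise_rational (fun y => \prod_(i <- r) F i y).
Proof.
move=> ratF; elim: r => [|i r ih].
  under [fun y => _]funext do rewrite big_nil.
  exact: piecewise_rational_cst.
under [fun y => _]funext do rewrite big_cons.
exact: piecewise_rationalM.
Qed.

Lemma piecewise_rational_common (I : finType) (F : I -> 'rV[R]_m -> R) :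
  (forall i, piecewise_rational (F i)) ->
  exists hs, forall y i, rational_on (sign_cell hs y) (F i).
Proof.
move=> /choice[hs ratF]; exists (flatten [seq hs i | i <- enum I]) => y i.
apply: rational_on_sub (ratF i y) => z yz h hh; apply: yz.
by apply/flatten_mapP; exists i => //; rewrite mem_enum.
Qed.

Lemma peval_continuous p : continuous (peval p : 'rV[R]_m -> R).
Proof.
move=> y; rewrite (_ : peval p = fun y : 'rV[R]_m => \sum_(c <- msupp p)
    mcoeff c p * \prod_(i < m) y ord0 i ^+ c i); last first.
  by apply/funext => z; rewrite /Defs.peval mevalE.
apply: continuous_at_sum => c _.
apply: continuous_atM; first exact: continuous_at_cst.
apply: continuous_at_prod => i _.
by apply: continuous_atX; exact: coord_continuous.
Qed.

End RationalFunctions.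

(** * From piecewise rational functions to piecewise-regular maps *)

Section PiecewiseRationalRegular.
Context {R : realType} {V : variety R}.
Local Notation E := (@vembed R V).
Local Notation peval := (@peval R (vdim V)).

Lemma vembed_continuous : continuous E.
Proof. exact: initial_continuous. Qed.

Lemma zopen_vembed (B : set 'rV[R]_(vdim V)) :
  algebraic B -> zopen [set x : V | ~ B (E x)].
Proof.
move=> algB; have [[chart_open _] _] := @vchart_iso R V.
by apply: (chart_open [set x | ~ B (val x)]); exists B.
Qed.

Lemma zclosed_vembed (B : set 'rV[R]_(vdim V)) :
  algebraic B -> zclosed [set x : V | B (E x)].
Proof. exact: zopen_vembed. Qed.

Lemma regfun_vembed (B : set 'rV[R]_(vdim V)) p q : algebraic B ->
    (forall x : V, ~ B (E x) -> peval q (E x) != 0) ->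
  regfun [set x : V | ~ B (E x)] (fun x => peval p (E x) / peval q (E x)).
Proof.
move=> algB q0; have [[_ chart_reg] [psi [_ psiK _]]] := @vchart_iso R V.
apply: (chart_reg [set x | ~ B (val x)]
  (fun x => peval p (val x) / peval q (val x))).
  by exists B.
move=> x Bx; exists [set x | ~ B (val x)], p, q; split=> //; first by exists B.
(* [q0] speaks of points of [V], so the model point [y] is brought back by the inverse chart. *)
move=> y By; split=> //; have := q0 (psi y).
by rewrite /vembed psiK; exact.
Qed.

(** The quotients that give [F] on the image of [C] define a map wherever their denominators do not
    vanish. There it sends all of [zclosure C] into the sphere, since the sphere equation pulls back
    to a Zariski closed condition that holds on [C]. *)
Lemma regular_on_rational n (X C : set V) (f : X -> sphere R n)
    (F : 'rV[R]_(vdim V) -> 'rV[R]_n.+1) (CX : C `<=` X) :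
    (forall x : X, C (val x) -> val (f x) = F (E (val x))) ->
    (forall i, rational_on (E @` C) (fun y => F y ord0 i)) ->
  regular_on f C.
Proof.
move=> fF /choice[p /choice[q pq]].
pose r y : 'rV[R]_n.+1 := \row_i (peval (p i) y / peval (q i) y).
pose Q : mpoly _ R := \prod_i q i.
have Q_neq0 y : peval Q y != 0 <-> forall i, peval (q i) y != 0.
  rewrite /Q peval_prod; split=> [/prodf_neq0 h i|h]; first exact: h.
  by apply/prodf_neq0 => i _; exact: h.
pose D := [set y | peval Q y != 0].
have ratr i : rational_on D (fun y => r y ord0 i).
  by exists (p i), (q i) => y /Q_neq0 /(_ i) qi; rewrite mxE.
have CD x : C x -> D (E x).
  by move=> Cx; apply/Q_neq0 => i; have [] := pq i (E x); first by exists x.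
have rC (x : X) : C (val x) -> r (E (val x)) = val (f x).
  move=> Cx; apply/rowP => i; rewrite mxE fF//.
  by have [|_ ->] := pq i (E (val x)); first by exists (val x).
pose O := [set x : V | ~ peval Q (E x) = 0].
have OD x : O x <-> D (E x) by split=> /eqP.
have [Bs algBs BsP] := algebraic_preimage ratr (sphere_algebraic n).
have Zs (z : V) : (zclosure C `&` O) z -> sphere_set (r (E z)).
  move=> [Cz /OD Dz]; apply/BsP => //; apply: (Cz [set x | Bs (E x)]).
  split=> [|x Cx]; first exact: zclosed_vembed.
  apply/BsP; first exact: CD.
  by rewrite (rC (SigSub (mem_set (CX _ Cx))))//; exact: set_valP.
exists O; split=> [|x /CD /OD//|]; first exact: (zopen_vembed (algebraic0 Q)).
pose g (z : Defs.induced (zclosure C `&` O)) : sphere R n :=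
  SigSub (mem_set (Zs (val z) (set_valP z))).
exists g; last first.
  by move=> x z Cx zx; apply: val_inj; rewrite /= zx; exact: rC.
have zD (z : Defs.induced (zclosure C `&` O)) : D (E (val z)).
  by have [_ /OD] := set_valP z.
split=> [U [B algB ->]|U h [B algB ->] hreg z Uz].
  have [B' algB' B'P] := algebraic_preimage ratr algB.
  exists [set x | ~ B' (E x)]; first exact: (zopen_vembed algB').
  by apply/seteqP; split=> z /=; have := B'P _ (zD z); tauto.
have [W1 [P1 [P2 [[B1 algB1 ->] W1z W1U hP]]]] := hreg (g z) Uz.
have [B' algB' B'P] := algebraic_preimage ratr algB1.
have [a [b ab]] := rational_on_comp P1 ratr.
have [c [d cd]] := rational_on_comp P2 ratr.
(* The zeros of [b * c] are removed because [regfun_vembed] wants a denominator without zeros on the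
   whole open subset of [V], whereas [key] controls it only on [zclosure C] inside [O]. *)
exists [set x | ~ (B' `|` [set y | peval (b * c) y = 0]) (E x)].
exists (fun x => peval (a * d) (E x) / peval (b * c) (E x)).
have key (y : Defs.induced (zclosure C `&` O)) : ~ B' (E (val y)) ->
    [/\ ~ B1 (val (g y)), peval (b * c) (E (val y)) != 0 &
     h (g y) = peval (a * d) (E (val y)) / peval (b * c) (E (val y))].
  move=> B'y; have Dy := zD y.
  have B1y : ~ B1 (r (E (val y))) by have := B'P _ Dy; tauto.
  have [P2y hE] := hP (g y) B1y.
  have [b0 P1E] := ab _ Dy; have [d0 P2E] := cd _ Dy.
  have c0 : peval c (E (val y)) != 0.
    by apply: contra_neq P2y => c0; rewrite P2E c0 mul0r.
  split=> //; first by rewrite pevalM mulf_neq0.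
  by rewrite hE P1E P2E !pevalM invf_div mulf_div.
have B'z : ~ B' (E (val z)) by move/(B'P _ (zD z)).
split.
- by apply/zopen_vembed/algebraicU0.
- apply: regfun_vembed; first exact: algebraicU0.
  by move=> x /not_orP[_ /eqP].
- by have [_ bc0 _] := key z B'z; move=> [//|/= bc]; move: bc0; rewrite bc eqxx.
- move=> y /not_orP[/key[B1y _ hE] _]; split; last exact: hE.
  exact: W1U.
Qed.

(** Strata record vanishing only, since sign conditions need not be Zariski locally closed; signs
    are recovered on connected components. An unrealized pattern gives an empty stratum. *)
Definition zero_stratum (hs : seq (mpoly (vdim V) R)) (t : seq bool) : set V :=
  [set x | [seq peval h (E x) == 0 | h <- hs] = t].

Lemma zero_stratum_locally_zclosed hs t : locally_zclosed (zero_stratum hs t).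
Proof.
have algT : algebraic [set: 'rV[R]_(vdim V)].
  by exists set0; apply/seteqP; split=> y //= _ p [].
have [[x xt]|no] := pselect (exists x, zero_stratum hs t x); last first.
  exists [set x | ~ setT (E x)], [set x | setT (E x)].
  split; [exact: (zopen_vembed algT)|exact: (zclosed_vembed algT)|].
  by apply/seteqP; split=> x /= => [xt|[/(_ I)]//]; case: no; exists x.
(* The polynomials that vanish at [x] give the closed part of the stratum, the product of the others
   gives the open part. *)
pose F := [set y | forall p, (p \in hs /\ peval p (E x) = 0) -> peval p y = 0].
pose Q : mpoly _ R := \prod_(h <- hs | peval h (E x) != 0) h.
exists [set y | ~ [set z | peval Q z = 0] (E y)], [set y | F (E y)]; split.
- exact/zopen_vembed/algebraic0.
- by apply: zclosed_vembed; eexists.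
have -> : zero_stratum hs t = [set y | forall h, h \in hs ->
    (peval h (E y) == 0) = (peval h (E x) == 0)].
  by rewrite /zero_stratum -xt; apply/seteqP; split=> y /= /eq_in_map.
apply/seteqP; split=> y /= => [yx|[/eqP]].
  split=> [|h [/yx hy /eqP]]; last by rewrite -hy => /eqP.
  apply/eqP; rewrite peval_prod prodf_seq_neq0; apply/allP => h /yx ->.
  exact: implybb.
rewrite peval_prod prodf_seq_neq0 => /allP Qy Fy h hhs.
have [hx|hx] := eqVneq (peval h (E x)) 0; first by apply/eqP/Fy.
by have := Qy _ hhs; rewrite hx => /negPf.
Qed.

Lemma zero_stratum_stratification hs :
  stratification (range (fun t : (size hs).-tuple bool => zero_stratum hs t)).
Proof.
split.
- exact: finite_image.
- by move=> _ [t _ <-]; exact: zero_stratum_locally_zclosed.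
- by move=> _ _ [t _ <-] [u _ <-] [x [<- <-]].
- apply/seteqP; split=> // x _.
  pose t := [tuple of [seq peval h (E x) == 0 | h <- in_tuple hs]].
  by exists (zero_stratum hs t) => //; exists t.
Qed.

(** On a stratum each [h] is identically zero or nowhere zero; in the latter case its sign is
    constant on a connected set by the intermediate value theorem. *)
Lemma connected_sign_cell hs t (X : set V) x :
  (X `&` zero_stratum hs t) x ->
  E @` connected_component (X `&` zero_stratum hs t) x `<=` sign_cell hs (E x).
Proof.
move=> Sx _ [y Cy <-] h hhs.
have sameh z : connected_component (X `&` zero_stratum hs t) x z ->
    (peval h (E z) == 0) = (peval h (E x) == 0).
  move=> /connected_component_sub[_ zt]; move: Sx => [_ xt].
  by move: zt; rewrite -xt => /eq_in_map/(_ h hhs).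
have [hx|hx] := eqVneq (peval h (E x)) 0.
  by have := sameh _ Cy; rewrite hx eqxx => /eqP ->.
have Cx := connected_component_refl Sx.
set C := connected_component _ _ in Cx Cy sameh *.
have /connected_intervalP itv : connected ((peval h \o E) @` C).
  apply: connected_continuous_connected; first exact: component_connected.
  apply: continuous_subspaceT => z.
  by apply: continuous_comp; [exact: vembed_continuous|exact: peval_continuous].
(* A change of sign would put 0 in the interval of values of [h] on [C], although [h] has no zero
   there. *)
apply: contrapT => hxy.
have [z Cz hz] : ((peval h \o E) @` C) 0.
  have hxC : ((peval h \o E) @` C) (peval h (E x)) by exists x.
  have hyC : ((peval h \o E) @` C) (peval h (E y)) by exists y.
  case: (leP 0 (peval h (E x))) hxy => [x0|/ltW x0].
    by case: leP => // /ltW y0 _; apply: (itv _ _ hyC hxC); rewrite y0 x0.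
  by case: leP => // y0 _; apply: (itv _ _ hxC hyC); rewrite y0 x0.
by have := sameh z Cz; rewrite [peval h (E z)]hz eqxx (negPf hx).
Qed.

Lemma piecewise_rational_regular n (X : set V) (f : X -> sphere R n)
    (F : 'rV[R]_(vdim V) -> 'rV[R]_n.+1) : continuous f ->
    (forall x : X, val (f x) = F (E (val x))) ->
    (forall i, piecewise_rational (fun y => F y ord0 i)) ->
  piecewise_regular f.
Proof.
move=> cf fF /piecewise_rational_common[hs ratF].
exists (range (fun t : (size hs).-tuple bool => zero_stratum hs t)).
  exact: zero_stratum_stratification.
split=> // _ x [t _ <-] Sx; apply: (@regular_on_rational _ _ _ _ F) => //.
  by move=> y /connected_component_sub[].
by move=> i; apply: rational_on_sub (ratF (E x) i); exact: connected_sign_cell.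
Qed.

End PiecewiseRationalRegular.

(** * A continuous piecewise rational retraction of the punctured space onto the sphere *)

Section Retraction.
Context {R : realType} {n : nat}.
Implicit Types (u : 'rV[R]_n.+1) (e k l : R).

Definition tail_sqnorm u := \sum_(i < n) u ord0 (lift ord0 i) ^+ 2.

(* The inverse of the stereographic projection from the pole
   [(- e, 0, ..., 0)], where [e = 1] or [e = -1], at [(l / k) u'], for
   [u = (u_0, u')]. *)
Definition stereo e k l u : 'rV[R]_n.+1 :=
  \row_i ((if i == ord0 then e * (k ^+ 2 - tail_sqnorm u * l ^+ 2)
           else 2 * k * l * u ord0 i) / (k ^+ 2 + tail_sqnorm u * l ^+ 2)).

(* On the sphere [tail_sqnorm u = 1 - u_0 ^+ 2], hence
   [north_scale u = 1 + Num.max u_0 0] and both branches fix [u]. *)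
Definition north_scale u : R :=
  tail_sqnorm u + Num.max (u ord0 ord0) 0 + Num.max (u ord0 ord0) 0 ^+ 2.

(** The maximum in the last scale is 0 when this branch is selected; it makes the same formula valid
    on the other side of the equator. The origin goes to [(-1, 0, ..., 0)], and the map is
    discontinuous there. *)
Definition sphere_retraction u : 'rV[R]_n.+1 :=
  if 0 <= - u ord0 ord0 then stereo (-1) (1 - u ord0 ord0) 1 u
  else stereo 1 (north_scale u) (1 + Num.max (- u ord0 ord0) 0) u.

Lemma tail_sqnorm_ge0 u : 0 <= tail_sqnorm u.
Proof. by apply: sumr_ge0 => i _; exact: sqr_ge0. Qed.

Lemma sphere_setE u :
  sphere_set u <-> u ord0 ord0 ^+ 2 + tail_sqnorm u = 1.
Proof. by rewrite /sphere_set /= big_ord_recl. Qed.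

Lemma row_eq0_tail u : u ord0 ord0 = 0 -> tail_sqnorm u = 0 -> u = 0.
Proof.
move=> u0 /eqP; rewrite psumr_eq0 => [/allP a0|i _]; last exact: sqr_ge0.
apply/rowP => i; rewrite mxE; have [j ->|->//] := unliftP ord0 i.
by have := a0 j; rewrite mem_index_enum sqrf_eq0 => /(_ isT)/eqP.
Qed.

(** This is [(k^2 - a l^2)^2 + 4 k^2 l^2 a = (k^2 + a l^2)^2], where [a] is the squared norm of
    [u']. *)
Lemma stereo_sphere e k l u : e ^+ 2 = 1 ->
  k ^+ 2 + tail_sqnorm u * l ^+ 2 != 0 -> sphere_set (stereo e k l u).
Proof.
move=> e1 d0; apply/sphere_setE; rewrite !mxE eqxx.
have -> : tail_sqnorm (stereo e k l u) =
    (2 * k * l / (k ^+ 2 + tail_sqnorm u * l ^+ 2)) ^+ 2 * tail_sqnorm u.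
  rewrite {1}/tail_sqnorm mulr_sumr; apply: eq_bigr => i _.
  by rewrite mxE lift_eqF -exprMn; congr (_ ^+ 2); rewrite mulrAC.
move: d0; set a := tail_sqnorm u => d0; rewrite exprMn (exprMn _ e) e1.
by field.
Qed.

Lemma south_denom_neq0 u : u ord0 ord0 <= 0 ->
  (1 - u ord0 ord0) ^+ 2 + tail_sqnorm u * 1 ^+ 2 != 0.
Proof.
move=> u0; rewrite gt_eqF// ltr_wpDr//.
  by rewrite expr1n mulr1 tail_sqnorm_ge0.
by rewrite exprn_gt0//; lra.
Qed.

Lemma max0_ge0 (x : R) : 0 <= Num.max x 0.
Proof. by rewrite le_max lexx orbT. Qed.

Lemma north_denom_neq0 u : 0 < u ord0 ord0 \/ tail_sqnorm u != 0 ->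
  north_scale u ^+ 2 +
    tail_sqnorm u * (1 + Num.max (- u ord0 ord0) 0) ^+ 2 != 0.
Proof.
move=> h; have a0 := tail_sqnorm_ge0 u.
have p0 := max0_ge0 (u ord0 ord0).
rewrite gt_eqF// ltr_wpDr//; first by rewrite mulr_ge0// sqr_ge0.
rewrite exprn_gt0// /north_scale; case: h => [u0|].
  rewrite ltr_wpDr ?sqr_ge0// ltr_wpDl// lt_max u0//.
by rewrite neq_lt ltNge a0 /= => a1; rewrite ltr_wpDr ?sqr_ge0// ltr_wpDr.
Qed.

Lemma sphere_retraction_sphere u : u != 0 -> sphere_set (sphere_retraction u).
Proof.
move=> u0; rewrite /sphere_retraction; case: ifPn; rewrite oppr_ge0.
  by move=> /south_denom_neq0; apply: stereo_sphere; rewrite sqrrN expr1n.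
rewrite -ltNge => u0_gt0; apply: stereo_sphere; first by rewrite expr1n.
by apply: north_denom_neq0; left.
Qed.

Lemma sphere_retraction_id u : sphere_set u -> sphere_retraction u = u.
Proof.
move=> /sphere_setE su; have aE : tail_sqnorm u = 1 - u ord0 ord0 ^+ 2 by lra.
apply/rowP => i; rewrite /sphere_retraction oppr_ge0.
case: (leP (u ord0 ord0) 0) => u0; rewrite mxE.
  have d0 : 1 - u ord0 ord0 != 0 by rewrite gt_eqF//; lra.
  rewrite aE (_ : (1 - _) ^+ 2 + _ * _ = 2 * (1 - u ord0 ord0)); last by ring.
  by case: eqP => [->|_]; field.
have d0 : 1 + u ord0 ord0 != 0 by rewrite gt_eqF//; lra.
have -> : north_scale u = 1 + u ord0 ord0.
  by rewrite /north_scale aE (max_idPl (ltW u0)); ring.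
have -> : 1 + Num.max (- u ord0 ord0) 0 = 1.
  by rewrite (max_idPr _) ?addr0//; lra.
rewrite aE (_ : (1 + _) ^+ 2 + _ * _ = 2 * (1 + u ord0 ord0)); last by ring.
by case: eqP => [->|_]; field.
Qed.

(** The stereographic coordinates are [(1 - u_0) u' / |u'|^2] and [u' / (1 - u_0)]. Inversion in the
    unit sphere exchanges them, and this is the transition between the projections from opposite
    poles. *)
Lemma stereo_north_south u : u ord0 ord0 <= 0 -> tail_sqnorm u != 0 ->
  stereo 1 (north_scale u) (1 + Num.max (- u ord0 ord0) 0) u =
  stereo (-1) (1 - u ord0 ord0) 1 u.
Proof.
move=> u0 a0; apply/rowP => i; rewrite !mxE /north_scale.
rewrite (max_idPr u0) (max_idPl _); last by rewrite oppr_ge0.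
rewrite expr0n !addr0; have := south_denom_neq0 u0.
move: a0; set a := tail_sqnorm u => a0 d0.
have d1 : a ^+ 2 + a * (1 - u ord0 ord0) ^+ 2 != 0.
  rewrite (_ : _ + _ = a * ((1 - u ord0 ord0) ^+ 2 + a * 1 ^+ 2)).
    exact: mulf_neq0.
  by ring.
by case: eqP => _; field; rewrite d1 andbT; move: d0; rewrite expr1n mulr1.
Qed.

Context {T : topologicalType}.
Implicit Types (v : T -> 'rV[R]_n.+1) (x : T).

Lemma continuous_at_tail v x :
  (forall i, {for x, continuous (fun y => v y ord0 i)}) ->
  {for x, continuous (fun y => tail_sqnorm (v y))}.
Proof.
by move=> cv; apply: continuous_at_sum => i _; apply: continuous_atX.
Qed.

Lemma continuous_at_stereo e (k l : T -> R) v x :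
    {for x, continuous k} -> {for x, continuous l} ->
    (forall i, {for x, continuous (fun y => v y ord0 i)}) ->
    k x ^+ 2 + tail_sqnorm (v x) * l x ^+ 2 != 0 ->
  {for x, continuous (fun y => stereo e (k y) (l y) (v y))}.
Proof.
move=> ck cl cv d0; have ca := continuous_at_tail cv.
have ck2 := continuous_atX (k := 2) ck.
have cal := continuous_atM ca (continuous_atX (k := 2) cl).
apply: continuous_at_row => i.
have -> : (fun y => stereo e (k y) (l y) (v y) ord0 i) = fun y =>
    (if i == ord0 then e * (k y ^+ 2 - tail_sqnorm (v y) * l y ^+ 2)
     else 2 * k y * l y * v y ord0 i) /
    (k y ^+ 2 + tail_sqnorm (v y) * l y ^+ 2).
  by apply/funext => y; rewrite mxE.
apply: continuous_atM; last first.
  by apply: continuous_atV => //; exact: continuous_atD.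
case: eqP => _.
  apply: continuous_atM; first exact: continuous_at_cst.
  by apply: continuous_atD => //; exact: continuous_atN.
apply: continuous_atM => //; apply: continuous_atM => //.
by apply: continuous_atM => //; exact: continuous_at_cst.
Qed.

(** Near a point with [u_0 < 0] only the first branch occurs. Otherwise [u_0 > 0] or [u'] is
    nonzero, an open condition under which the north formula gives the retraction on both sides of
    the equator. *)
Lemma continuous_at_sphere_retraction v x :
    (forall i, {for x, continuous (fun y => v y ord0 i)}) -> v x != 0 ->
  {for x, continuous (fun y => sphere_retraction (v y))}.
Proof.
move=> cv v0; have cN := continuous_atN (cv ord0).
have ca := continuous_at_tail cv.
have cp c := continuous_at_max c (@continuous_at_cst _ _ 0 x).
have [v00|v00] := ltP (v x ord0 ord0) 0.
  have near_south : \forall y \near x, v y ord0 ord0 < 0.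
    exact: cvgr_lt (cv ord0) _ v00.
  apply: (@continuous_at_eq_near _ _ _
      (fun y => stereo (-1) (1 - v y ord0 ord0) 1 (v y))).
    apply: filterS near_south => y /ltW y0.
    by rewrite /sphere_retraction oppr_ge0 y0.
  apply: continuous_at_stereo => //.
  - by apply: continuous_atD => //; exact: continuous_at_cst.
  - exact: continuous_at_cst.
  - by apply: south_denom_neq0; exact: ltW.
have far x' : 0 < v x' ord0 ord0 \/ tail_sqnorm (v x') != 0 ->
    sphere_retraction (v x') =
    stereo 1 (north_scale (v x')) (1 + Num.max (- v x' ord0 ord0) 0) (v x').
  rewrite /sphere_retraction oppr_ge0; case: leP => // y0 [//|a0].
  by rewrite stereo_north_south.
have h : 0 < v x ord0 ord0 \/ tail_sqnorm (v x) != 0.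
  move: v00; rewrite le_eqVlt => /orP[/eqP v00|]; last by left.
  by right; apply: contra_neq v0; exact: row_eq0_tail.
apply: continuous_at_eq_near.
  have : \forall y \near x, 0 < v y ord0 ord0 \/ tail_sqnorm (v y) != 0.
    case: h => [v0_gt0|a0].
      have : \forall y \near x, 0 < v y ord0 ord0.
        exact: cvgr_gt (cv ord0) _ v0_gt0.
      by apply: filterS => y; left.
    have : \forall y \near x, tail_sqnorm (v y) != 0 by exact: cvgr_neq0 ca a0.
    by apply: filterS => y; right.
  by apply: filterS => y; exact: far.
apply: continuous_at_stereo => //.
- apply: continuous_atD; last by apply: continuous_atX; exact: cp.
  by apply: continuous_atD => //; exact: cp.
- apply: continuous_atD; first exact: continuous_at_cst.
  exact: cp.
- exact: north_denom_neq0.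
Qed.

End Retraction.

(** * Piecewise rationality of the retraction *)

Section RetractionPiecewiseRational.
Context {R : realType} {m n : nat}.
Implicit Types (F : 'rV[R]_m -> 'rV[R]_n.+1) (k l : 'rV[R]_m -> R).

Lemma piecewise_rational_stereo e k l F i :
    piecewise_rational k -> piecewise_rational l ->
    (forall i, piecewise_rational (fun y => F y ord0 i)) ->
  piecewise_rational (fun y => stereo e (k y) (l y) (F y) ord0 i).
Proof.
move=> ratk ratl ratF; under [fun y => _]funext do rewrite mxE !expr2.
have rata : piecewise_rational (fun y => tail_sqnorm (F y)).
  apply: piecewise_rational_sum => j; under [fun y => _]funext do rewrite expr2.
  exact: piecewise_rationalM.
have ratkk := piecewise_rationalM ratk ratk.
have ratall := piecewise_rationalM rata (piecewise_rationalM ratl ratl).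
apply: piecewise_rationalM; last first.
  by apply: piecewise_rationalV; exact: piecewise_rationalD.
case: eqP => _.
  apply: piecewise_rationalM; first exact: piecewise_rational_cst.
  by apply: piecewise_rationalD => //; exact: piecewise_rationalN.
apply: piecewise_rationalM => //; apply: piecewise_rationalM => //.
by apply: piecewise_rationalM => //; exact: piecewise_rational_cst.
Qed.

Lemma piecewise_rational_sphere_retraction F i :
    (forall i, piecewise_rational (fun y => F y ord0 i)) ->
  piecewise_rational (fun y => sphere_retraction (F y) ord0 i).
Proof.
move=> ratF; have ratN := piecewise_rationalN (ratF ord0).
have ratp (h : 'rV[R]_m -> R) (rath : piecewise_rational h) :=
  piecewise_rational_max rath (piecewise_rational_cst 0).
rewrite (_ : (fun y => _) = fun y => if 0 <= - F y ord0 ord0 then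
    stereo (-1) (1 - F y ord0 ord0) 1 (F y) ord0 i
  else stereo 1 (north_scale (F y)) (1 + Num.max (- F y ord0 ord0) 0) (F y)
    ord0 i).
  apply: piecewise_rational_if => //; apply: piecewise_rational_stereo => //.
  - by apply: piecewise_rationalD => //; exact: piecewise_rational_cst.
  - exact: piecewise_rational_cst.
  - under [fun y => _]funext do rewrite /north_scale !expr2.
    apply: piecewise_rationalD; last first.
      by apply: piecewise_rationalM; exact: ratp.
    apply: piecewise_rationalD; last exact: ratp.
    apply: piecewise_rational_sum => j.
    under [fun y => _]funext do rewrite expr2.
    exact: piecewise_rationalM.
  - by apply: piecewise_rationalD; [exact: piecewise_rational_cst|exact: ratp].
by apply/funext => y; rewrite /sphere_retraction; case: ifP.
Qed.

End RetractionPiecewiseRational.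

(** * Tent functions *)

Section Tent.
Context {R : realType} {m : nat}.
Implicit Types (c y : 'rV[R]_m) (d : R).

(** A product over the coordinates has polynomial pieces and is nonzero exactly on an open ball of
    the sup norm. *)
Definition tent c d y : R :=
  \prod_(i < m) Num.max (d - `|y ord0 i - c ord0 i|) 0.

Lemma tent_ge0 c d y : 0 <= tent c d y.
Proof. by apply: prodr_ge0 => i _; exact: max0_ge0. Qed.

Lemma tent_neq0 c d y : 0 < d -> (tent c d y != 0) = `[< ball c d y >].
Proof.
move=> d0; apply/idP/asboolP => [/prodf_neq0 ty|[_ cdy]].
  split=> // i j; rewrite ord1; rewrite /ball /= distrC -subr_gt0 ltNge.
  by apply: contraT => /negPn/max_idPr h; have := ty j isT; rewrite h eqxx.
apply/prodf_neq0 => i _; have := cdy ord0 i; rewrite /ball /= distrC => h.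
by rewrite gt_eqF// lt_max subr_gt0 h.
Qed.

Lemma piecewise_rational_tent c d : piecewise_rational (tent c d).
Proof.
apply: piecewise_rational_prod => i; apply: piecewise_rational_max; last first.
  exact: piecewise_rational_cst.
apply: piecewise_rationalD; first exact: piecewise_rational_cst.
apply: piecewise_rationalN.
have rat : piecewise_rational (fun y => y ord0 i + - c ord0 i).
  apply: piecewise_rationalD; first exact: piecewise_rational_coord.
  exact: piecewise_rational_cst.
under [fun y => _]funext do rewrite -maxrN.
by apply: piecewise_rational_max => //; exact: piecewise_rationalN.
Qed.

Lemma tent_continuous c d (T : topologicalType) (v : T -> 'rV[R]_m) x :
  (forall i, {for x, continuous (fun z => v z ord0 i)}) ->
  {for x, continuous (fun z => tent c d (v z))}.
Proof.
move=> cv; apply: continuous_at_prod => i _.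
apply: continuous_at_max; last exact: continuous_at_cst.
apply: continuous_atD; first exact: continuous_at_cst.
apply: continuous_atN.
have cvi : {for x, continuous (fun z => v z ord0 i - c ord0 i)}.
  by apply: continuous_atD => //; exact: continuous_at_cst.
exact: cvg_norm cvi.
Qed.

End Tent.

(** * Uniform piecewise rational approximation on a compact set *)

Section Approximation.
Context {R : realType} {V : variety R} {X : set V}.
Local Notation E := (@vembed R V).

Lemma nbhs_vembed (x : X) (A : set X) : nbhs x A ->
  exists2 d, 0 < d & forall z : X, ball (E (val x)) d (E (val z)) -> A z.
Proof.
move=> [_ [[W [B oB <-] <-] /= Bx WA]].
have /nbhs_ballP[d d0 dB] : nbhs (E (val x)) B by exact: open_nbhs_nbhs.
by exists d => // z /dB; exact: WA.
Qed.

Lemma vembed_val_continuous : continuous (fun x : X => E (val x)).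
Proof.
move=> x; apply: continuous_comp; first exact: initial_continuous.
exact: vembed_continuous.
Qed.

(** [F] is a weighted mean of values [f c]: at [x], only the centres [c] whose ball contains [E x]
    have nonzero weight, and for these [f c] is close to [f x]. *)
Lemma piecewise_rational_approx k (f : X -> 'rV[R]_k) (e : R) :
    compact X -> continuous f -> 0 < e ->
  exists F : 'rV[R]_(vdim V) -> 'rV[R]_k,
    [/\ forall i, piecewise_rational (fun y => F y ord0 i),
        forall (x : X) i,
          {for x, continuous (fun z : X => F (E (val z)) ord0 i)} &
        forall x : X, ball (f x) e (F (E (val x)))].
Proof.
(* The mean is only bounded non-strictly; [e / 2] leaves room for the strict bound by [e]. *)
move=> cX cf e0; have e20 : 0 < e / 2 by rewrite divr_gt0.
have /choice[d dP] (c : X) : exists d, 0 < d /\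
    forall z : X, ball (E (val c)) d (E (val z)) -> ball (f c) (e / 2) (f z).
  have [d d0 dA] := nbhs_vembed (cf c _ (nbhsx_ballx (f c) _ e20)).
  by exists d.
have cK : compact (E @` X).
  apply: continuous_compact => //.
  exact: continuous_subspaceT vembed_continuous.
have [D cover] : exists D : seq X, forall x : X,
    exists2 c, c \in D & ball (E (val c)) (d c) (E (val x)).
  have [D _ cover] : finite_subset_cover setT
      (fun c : X => ball (E (val c)) (d c)) (E @` X).
    move: cK; rewrite compact_cover; apply.
      by move=> c _; apply: ball_open; have [] := dP c.
    move=> _ [x Xx <-]; exists (exist _ x (mem_set Xx)) => //=.
    by apply: ballxx; have [] := dP (exist _ x (mem_set Xx)).
  exists (finmap.enum_fset D) => x.
  have [|c cD xc] := cover (E (val x)); last by exists c.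
  by exists (val x) => //; exact: set_valP.
pose t c := tent (E (val c)) (d c).
pose S y := \sum_(c <- D) t c y.
(* Where [S] vanishes the value is 0 by convention; this happens only outside the image of [X]. *)
exists (fun y => \row_i ((\sum_(c <- D) t c y * f c ord0 i) * (S y)^-1)).
have S0 (x : X) : 0 < S (E (val x)).
  have [c Dc xc] := cover x.
  have d0 : 0 < d c by have [] := dP c.
  rewrite /S (big_rem c)//= ltr_wpDr//.
    by apply: sumr_ge0 => ? _; exact: tent_ge0.
  rewrite lt_neqAle tent_ge0 andbT eq_sym tent_neq0//; exact/asboolP.
split=> [i|x i|x].
- under [fun y => _]funext do rewrite mxE.
  apply: piecewise_rationalM; last apply: piecewise_rationalV;
    apply: piecewise_rational_sum => c.
  + apply: piecewise_rationalM; first exact: piecewise_rational_tent.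
    exact: piecewise_rational_cst.
  + exact: piecewise_rational_tent.
- have ct c : {for x, continuous (fun z : X => t c (E (val z)))}.
    apply: tent_continuous => j.
    apply: (@continuous_comp _ _ _ (fun z : X => E (val z))
      (fun y => y ord0 j)).
      exact: vembed_val_continuous.
    exact: coord_continuous.
  have -> : (fun z : X => (\row_i ((\sum_(c <- D) t c (E (val z)) *
      f c ord0 i) * (S (E (val z)))^-1) : 'rV[R]_k) ord0 i) = fun z : X =>
      (\sum_(c <- D) t c (E (val z)) * f c ord0 i) * (S (E (val z)))^-1.
    by apply/funext => z; rewrite mxE.
  apply: continuous_atM; last first.
    by apply: continuous_atV; [rewrite gt_eqF|exact: continuous_at_sum].
  apply: continuous_at_sum => c _; apply: continuous_atM => //.
  exact: continuous_at_cst.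
- split=> // i j; rewrite ord1 /ball /= mxE.
  have Sx := S0 x.
  (* The error is the same weighted mean, taken of the differences [f x - f c]. *)
  have -> : f x ord0 j -
      (\sum_(c <- D) t c (E (val x)) * f c ord0 j) * (S (E (val x)))^-1 =
      (\sum_(c <- D) t c (E (val x)) * (f x ord0 j - f c ord0 j)) /
      S (E (val x)).
    under [in RHS]eq_bigr do rewrite mulrBr.
    by rewrite sumrB -mulr_suml mulrBl mulrAC divff ?gt_eqF// mul1r.
  rewrite normrM normfV (gtr0_norm Sx) ltr_pdivrMr//.
  apply: (@le_lt_trans _ _ (e / 2 * S (E (val x)))); last first.
    by rewrite ltr_pM2r//; lra.
  rewrite /S mulr_sumr (le_trans (ler_norm_sum _ _ _))//; apply: ler_sum => c _.
  have [->|tx] := eqVneq (t c (E (val x))) 0.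
    by rewrite mul0r mulr0 normr0.
  rewrite normrM (ger0_norm (tent_ge0 _ _ _)) mulrC ler_wpM2r ?tent_ge0//.
  have [d0 dcP] := dP c.
  move: tx; rewrite tent_neq0// => /asboolP /dcP [_ /(_ ord0 j)].
  by rewrite /ball /= distrC => /ltW.
Qed.

End Approximation.

(** * Uniform control of the retraction near the sphere *)

Section SphereModulus.
Context {R : realType} {n : nat}.
Implicit Types u w : 'rV[R]_n.+1.

Lemma sphere_set_neq0 u : sphere_set u -> u != 0.
Proof.
move=> su; apply/eqP => u0; move: su; rewrite u0 /sphere_set /=.
under eq_bigr do rewrite mxE expr0n.
by rewrite big1 // => /esym/eqP; rewrite oner_eq0.
Qed.

Lemma compact_sphere_set : compact (@sphere_set R n).
Proof.
apply: bounded_closed_compact.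
  exists 1; split; first exact: num_real.
  move=> M M1 u su /=; rewrite [leLHS]/Num.Def.normr /= mx_normrE.
  apply/bigmax_leP; split=> [|[i j] _ /=]; first by apply: ltW; lra.
  rewrite ord1; have : u ord0 j ^+ 2 <= 1.
    rewrite -su (bigD1 j)//= lerDl; apply: sumr_ge0 => ? _; exact: sqr_ge0.
  rewrite -real_normK ?num_real// => h.
  have : `|u ord0 j| <= 1 by rewrite -(@ler_pXn2r _ 2) ?nnegrE// expr1n.
  lra.
have [P ->] := sphere_algebraic n (R := R).
have -> : [set x : 'rV[R]_n.+1 | forall p, P p -> peval p x = 0] =
    \bigcap_(p in P) (peval p @^-1` [set 0]) by [].
apply: closed_bigI => p _; apply: preimage_closed.
  by move=> x _; exact: peval_continuous.
exact: closed_eq.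
Qed.

(** The retraction is continuous at each point of the sphere and fixes it; compactness makes the
    radius uniform. *)
Lemma sphere_retraction_modulus (e : R) : 0 < e ->
  exists2 d, 0 < d & forall u w, sphere_set u -> ball u d w ->
    w != 0 /\ ball u e (sphere_retraction w).
Proof.
move=> e0.
have /compact_near_coveringP cov := compact_sphere_set.
pose good d u := forall w, ball u d w ->
  w != 0 /\ ball u e (sphere_retraction w).
have : \forall d \near (0 : R)^'+, @sphere_set R n `<=` good d.
  apply: cov => u su; have u0 := sphere_set_neq0 su.
  have cid : forall i, {for u, continuous (fun w : 'rV[R]_n.+1 => w ord0 i)}.
    by move=> i; exact: coord_continuous.
  have cr : {for u, continuous (@sphere_retraction R n)}.
    exact: continuous_at_sphere_retraction.
  have e20 : 0 < e / 2 by rewrite divr_gt0.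
  have near_r : \forall w \near u, ball u (e / 2) (sphere_retraction w).
    apply: cr; rewrite sphere_retraction_id//; exact: nbhsx_ballx.
  have near_0 : \forall w \near u, w != 0.
    by apply: (@cvgr_neq0 _ _ _ (nbhs u) _ id u) u0; exact: cvg_id.
  have : nbhs u [set w | w != 0 /\ ball u (e / 2) (sphere_retraction w)].
    exact: filterI near_0 near_r.
  move=> /nbhs_ballP[h /= h0 hP].
  have h20 : 0 < h / 2 by rewrite divr_gt0.
  (* The bound [h / 2] serves to reach [w] from [u] through [v], the bound [e / 2] to replace [u] by
     [v] as centre. *)
  exists (ball u (Num.min (h / 2) (e / 2)), [set d | d < h / 2]).
    split; last exact: nbhs_right_lt.
    by apply: nbhsx_ballx; rewrite lt_min h20.
  move=> [v d] [/= uv dh] w vw.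
  have uv_h : ball u (h / 2) v by apply: le_ball uv; rewrite ge_min lexx.
  have uv_e : ball u (e / 2) v by apply: le_ball uv; rewrite ge_min lexx orbT.
  have [|w0 uw] := hP w.
    rewrite (splitr h); apply: ball_triangle uv_h _.
    by apply: le_ball vw; exact: ltW.
  split=> //; rewrite (splitr e).
  by apply: ball_triangle uw; exact: ball_sym.
move=> near_good.
have [d [d0 dP]] := filter_ex (filterI (nbhs_right_gt (0 : R)) near_good).
by exists d => // u w su; exact: dP.
Qed.

End SphereModulus.

(** * The Euclidean topology of the sphere as a variety *)

Section SphereTopology.
Context {R : realType} {n : nat} {T : topologicalType}.

Lemma sphere_val_continuous (g : T -> sphere R n) :
  continuous g -> continuous (fun x => val (g x)).
Proof.
move=> cg x; apply: (@continuous_comp _ _ _ g (fun u : sphere R n => val u)).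
  exact: cg.
exact: (@vembed_continuous R (sphere R n)).
Qed.

Lemma sphere_continuous (g : T -> sphere R n) :
  continuous (fun x => val (g x)) -> continuous g.
Proof.
move=> cg x A [_ [[B oB <-] Bx BA]].
have nearB : \forall z \near x, B (val (g z)).
  by apply: cg; exact: open_nbhs_nbhs.
by apply: (filterS _ nearB) => z /BA.
Qed.

End SphereTopology.

(** * Uniform neighborhoods in the compact-open topology *)

Section CompactOpen.
Import ArrowAsCompactOpen.
Context {R : realType} {n : nat} {X : topologicalType}.

Lemma sphere_compact_open_nbhs (f : continuousType X (sphere R n))
    (N : set (continuousType X (sphere R n))) : nbhs f N ->
  exists2 e : R, 0 < e & forall g : continuousType X (sphere R n),
    (forall x, ball (val (f x)) e (val (g x))) -> N g.
Proof.
(* The maps uniformly close to [f] generate a filter; it suffices that this filter converges to [f]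
   in the compact-open topology. *)
pose U : set_system (X -> sphere R n) := filter_from [set e : R | 0 < e]
  (fun e => [set g | forall x, ball (val (f x)) e (val (g x))]).
have FU : Filter U.
  apply: filter_from_filter; first by exists 1 => /=.
  move=> a b /= a0 b0; exists (Num.min a b) => /=; first by rewrite lt_min a0.
  move=> g /= fg; split=> x; apply: le_ball (fg x); rewrite ge_min lexx ?orbT//.
have Uf : {compact-open, U --> (f : X -> sphere R n)}.
  apply/compact_open_cvgP => K _ cK [B oB <-] fKB.
  pose good e x := forall w : 'rV[R]_n.+1, ball (val (f x)) e w -> B w.
  have /compact_near_coveringP cov := cK.
  (* Compactness of [K] yields one radius for which the tube around [f] over [K] stays in [B]. *)
  have near_good : \forall e \near (0 : R)^'+, K `<=` good e.
    apply: cov => x Kx.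
    have Bfx : B (val (f x)) by apply: fKB; exists x.
    have /nbhs_ballP[h /= h0 hB] : nbhs (val (f x)) B by exact: open_nbhs_nbhs.
    have h20 : 0 < h / 2 by rewrite divr_gt0.
    exists ([set y | ball (val (f x)) (h / 2) (val (f y))],
        [set e | e < h / 2]).
      split; last exact: nbhs_right_lt.
      have cf := sphere_val_continuous (@cts_fun _ _ f).
      by apply: cf; exact: nbhsx_ballx.
    move=> [y e] [/= fxy eh] w yw; apply: hB; rewrite (splitr h).
    by apply: ball_triangle fxy _; apply: le_ball yw; exact: ltW.
  have [e [e0 eP]] := filter_ex (filterI (nbhs_right_gt (0 : R)) near_good).
  by exists e => // g fg _ [x Kx <-]; exact: eP (fg x).
move=> [_ [[W oW <-] /= Wf WN]].
have [e e0 eW] : U W by apply: Uf; exact: open_nbhs_nbhs.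
by exists e => // g fg; apply: WN; exact: eW.
Qed.

End CompactOpen.

(** * Composition of the approximation with the retraction *)

Import ArrowAsCompactOpen.

Theorem theorem1p5 (R : realType) (V : variety R) (X : set V) (n : nat)
  (compactX : compact X) (n_gt0 : (0 < n)%N)
  (f : continuousType X (sphere R n)) (N : set (continuousType X (sphere R n)))
  (nbhsN : nbhs f N) :
  exists2 g : continuousType X (sphere R n), N g & piecewise_regular g.
Proof.
(* The constants are chosen backwards: [e] from [N], then [d] from the retraction, then [F] within
   [d] of [f], so that [F] has no zero on the image of [X]. *)
have [e e0 eN] := sphere_compact_open_nbhs nbhsN.
have [d d0 dG] := @sphere_retraction_modulus R n e e0.
have cf := sphere_val_continuous (@cts_fun _ _ f).
have [F [ratF cF fF]] := piecewise_rational_approx compactX cf d0.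
have FG (x : X) := dG _ _ (set_valP (f x)) (fF x).
pose G y := sphere_retraction (F y).
pose E := @vembed R V.
have Gs (x : X) : sphere_set (G (E (val x))).
  by apply: sphere_retraction_sphere; have [] := FG x.
pose g (x : X) : sphere R n := exist _ (G (E (val x))) (mem_set (Gs x)).
have cg : continuous g.
  apply: sphere_continuous => x; apply: continuous_at_sphere_retraction.
    exact: cF.
  by have [] := FG x.
exists (mkcts cg); first by apply: eN => x; have [] := FG x.
apply: (@piecewise_rational_regular _ _ _ _ _ G) => //.
by move=> i; exact: piecewise_rational_sphere_retraction.
Qed.
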